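(* Let $B\ge 2$ be an integer. For every integer $k\ge 1$ there are only finitely many positive integers $n$ such that every base-$B$ subword of $n$ is divisible by at most $k$ distinct primes.
   Context: For a positive integer $n$ with base-$B$ expansion $n=\sum_{l=0}^m x_lB^l$ (digits $0\le x_l\le B-1$, leading digit $x_m\neq 0$), the base-$B$ subwords of $n$ are the integers $W(i,j)=\sum_{l=i}^{j}x_lB^{l-i}$ for $0\le i\le j\le m$. The condition is imposed on each subword separately, and primes are counted without multiplicity (so $1$ is divisible by no primes and $8=2^3$ by one prime). A subword equal to $0$ is divisible by every prime, hence by more than $k$ primes. *)

(* Defs.v *)
(* MathComp world. *)
From mathcomp Require Import all_boot.
From mathcomp Require Import classical_sets functions cardinality.

Set Implicit Arguments.
Unset Strict Implicit.
Unset Printing Implicit Defensive.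

(* Only the values [x 0, ..., x m] matter; [x m] is the leading digit. *)
Definition base_expansion (B n m : nat) (x : nat -> nat) : Prop :=
  [/\ forall l, l <= m -> x l < B,
      x m <> 0
    & n = \sum_(0 <= l < m.+1) x l * B ^ l].

Definition subword_value (B : nat) (x : nat -> nat) (i j : nat) : nat :=
  \sum_(i <= l < j.+1) x l * B ^ (l - i).

Definition is_subword (B n w : nat) : Prop :=
  exists (m : nat) (x : nat -> nat) (i j : nat),
    [/\ base_expansion B n m x, i <= j, j <= m & w = subword_value B x i j].

(* Not stated as [size (primes w) <= k], because [primes 0] is empty whereas
   every prime divides 0; here 0 fails the condition for every [k]. *)
Definition at_most_primes (k w : nat) : Prop :=
  forall s : seq nat,
    uniq s -> (forall p, p \in s -> prime p /\ p %| w) -> size s <= k.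

(* Main.v *)
(* Let M be a product of k+1 distinct primes not dividing B. If P_j is the
   number formed by the j lowest digits of n, then B^i W(i,j-1) = P_j - P_i,
   and B is invertible modulo M. As soon as n has at least M digits, two of
   P_0, ..., P_M agree modulo M, and the subword between them is a multiple
   of M (possibly 0). *)
Require Import Defs.
From mathcomp Require Import all_boot.
From mathcomp Require Import classical_sets functions cardinality.

Lemma exists_primes_above (b k : nat) :
  exists s : seq nat,
    [/\ uniq s, size s = k & forall p, p \in s -> prime p /\ b < p].
Proof.
elim: k => [|k [s [us ss ps]]]; first by exists [::].
(* A prime above the sum of [s] exceeds every member of [s], so it is new; adding [b] keeps it above
   the bound as well. *)
have [p p_gt p_pr] := prime_above (b + \sum_(q <- s) q).
exists (p :: s); split => /=; last 2 first.
- by rewrite ss.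
- move=> q; rewrite inE => /predU1P[->|/ps//].
  by split=> //; exact: leq_ltn_trans (leq_addr _ _) p_gt.
rewrite us andbT; apply/negP => p_s; move: p_gt.
by rewrite (big_rem p p_s) /= addnCA ltnNge leq_addr.
Qed.

Lemma sum_digits (B n j : nat) :
  \sum_(0 <= l < j) (n %/ B ^ l %% B) * B ^ l = n %% B ^ j.
Proof.
elim: j => [|j IHj]; first by rewrite big_nil expn0 modn1.
rewrite big_nat_recr //= IHj modn_divl -expnS expnSr.
(* The digit is now the quotient of [n %% B ^ j.+1] by [B ^ j]; its remainder is [n %% B ^ j], so
   [divn_eq] applies. *)
rewrite addnC -(modn_dvdm n (dvdn_mulr B (dvdnn (B ^ j)))).
by rewrite -expnSr -divn_eq.
Qed.

(** With [m] the truncated logarithm, [B ^ m <= n] makes the digit at [m] nonzero, and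
    [n < B ^ m.+1] leaves no digit beyond it. *)
Lemma base_expansion_digits {B n : nat} (hB : 1 < B) (n_gt0 : 0 < n) :
  base_expansion B n (trunc_log B n) (fun l => n %/ B ^ l %% B).
Proof.
have /andP[le_n lt_n] := trunc_log_bounds hB n_gt0.
split=> [l _| |]; first by rewrite ltn_mod ltnW.
- have Bm_gt0 : 0 < B ^ trunc_log B n by rewrite expn_gt0 ltnW.
  rewrite modn_small; last by rewrite ltn_divLR // -expnS.
  by apply/eqP; rewrite -lt0n divn_gt0.
- by rewrite sum_digits modn_small.
Qed.

Lemma sum_digits_subword (B : nat) (x : nat -> nat) (i j : nat) : i <= j ->
  \sum_(0 <= l < j.+1) x l * B ^ l =
  \sum_(0 <= l < i) x l * B ^ l + subword_value B x i j * B ^ i.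
Proof.
move=> le_ij; rewrite (big_cat_nat _ (leqW le_ij)) //=; congr (_ + _).
rewrite /subword_value big_distrl /=; apply: eq_big_nat => l /andP[le_il _].
by rewrite -mulnA -expnD subnK.
Qed.

Lemma dvdn_subword (B m M : nat) (x : nat -> nat) :
  0 < M -> coprime M B -> M <= m.+1 ->
  exists i j, [/\ i <= j, j <= m & M %| subword_value B x i j].
Proof.
move=> M_gt0 coMB le_Mm; pose P j := \sum_(0 <= l < j) x l * B ^ l.
pose f (j : 'I_M.+1) : 'I_M := Ordinal (ltn_pmod (P j) M_gt0).
have /injectivePn[a [b ne_ab fab]] : ~~ injectiveb f.
  by apply/negP => /injectiveP/leq_card; rewrite !card_ord ltnn.
wlog lt_ab : a b ne_ab fab / a < b.
  move=> IH; case: (ltngtP a b) => [|lt_ba|/val_inj eq_ab]; first exact: IH.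
    by apply: (IH b a); rewrite // eq_sym.
  by rewrite eq_ab eqxx in ne_ab.
have b_gt0 : 0 < b by apply: leq_ltn_trans lt_ab.
have le_ab : a <= b.-1 by rewrite -ltnS prednK.
(* [P b] covers the positions below [b], so the subword ends at [b.-1], which is at most [m] because
   [b <= M <= m.+1]. *)
exists a, b.-1; split=> //.
  by rewrite -ltnS prednK // (leq_trans _ le_Mm) // -ltnS.
have := sum_digits_subword B x a b.-1 le_ab; rewrite prednK // -/(P a) -/(P b).
move/(congr1 val): fab => /= /eqP fab Pb.
(* Multiplying by [B ^ a], coprime to [M], turns the subword into [P b - P a]. *)
rewrite -(Gauss_dvdl _ (coprimeXr a coMB)).
by move: fab; rewrite Pb -{1}[P a]addn0 eqn_modDl mod0n eq_sym.
Qed.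

Theorem corollary3p1p1 (B : nat) (hB : 2 <= B) (k : nat) (hk : 1 <= k) :
  finite_set
    [set n : nat | 0 < n /\
       forall w : nat, is_subword B n w -> at_most_primes k w]%classic.
Proof.
have [s [us ss ps]] := exists_primes_above B k.+1.
set M := \prod_(p <- s) p.
have M_gt0 : 0 < M.
  by rewrite /M big_seq; apply: prodn_cond_gt0 => p /ps[/prime_gt0].
have coMB : coprime M B.
  rewrite /M big_seq; apply: (big_ind (coprime^~ B)) => [|a b ca cb|p].
  - exact: coprime1n.
  - by rewrite coprimeMl ca.
  move=> /ps[p_pr lt_Bp]; rewrite prime_coprime //.
  by apply/negP => /(dvdn_leq (ltnW hB)); rewrite leqNgt lt_Bp.
(* All such [n] lie below [B ^ M]: any larger one has more than [M] digits. *)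
apply: (sub_finite_set _ (finite_II (B ^ M))) => n /= [n_gt0 hn].
rewrite ltnNge; apply/negP => le_n.
have le_Mm : M <= trunc_log B n by apply: trunc_log_max.
have [i [j [le_ij le_jm dvdMw]]] := dvdn_subword B _ M
  (fun l => n %/ B ^ l %% B) M_gt0 coMB (leqW le_Mm).
have /hn/(_ s us) : is_subword B n
    (subword_value B (fun l => n %/ B ^ l %% B) i j).
  exists (trunc_log B n), (fun l => n %/ B ^ l %% B), i, j.
  by split=> //; exact: base_expansion_digits.
(* The list [s] itself violates the bound: its [k.+1] primes divide [M], hence the subword, even if
   that is 0. *)
rewrite ss ltnn => le_k; suff: false by [].
apply: le_k => p p_s; split; first by have [] := ps p p_s.
by apply: dvdn_trans dvdMw; rewrite /M (big_rem p p_s) dvdn_mulr.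
Qed.
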